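(* Let $n\ge 1$ and $l\ge 0$ be integers with $2l\le n$. Let $A_L\subset\mathrm{End}\bigl(\mathrm{Sing}\,L_{\boldsymbol 1}[l]\bigr)$ be the Bethe algebra of the homogeneous XXX Heisenberg model acting on the space $\mathrm{Sing}\,L_{\boldsymbol 1}[l]$ of $\mathfrak{gl}_2$-singular vectors of weight $(n-l,l)$ in $(\mathbb C^2)^{\otimes n}$. Then $A_L$ has simple spectrum.
   Context: $e_{ab}$, $a,b\in\{1,2\}$, are the standard generators of $\mathfrak{gl}_2$. The Yangian $Y(\mathfrak{gl}_2)$ is the unital associative complex algebra with generators $T_{ab}^{\{s\}}$, $a,b\in\{1,2\}$, $s\ge1$; with $T_{ab}(u)=\delta_{ab}+\sum_{s\ge 1}T_{ab}^{\{s\}}u^{-s}$ its relations are $(u-v)\bigl(T_{ab}(u)T_{cd}(v)-T_{cd}(v)T_{ab}(u)\bigr)=T_{cb}(v)T_{ad}(u)-T_{cb}(u)T_{ad}(v)$ for all $a,b,c,d$. Its coproduct is $\Delta:T_{ab}(u)\mapsto\sum_{c=1}^2T_{cb}(u)\otimes T_{ac}(u)$. $U(\mathfrak{gl}_2)$ is embedded in $Y(\mathfrak{gl}_2)$ by $e_{ab}\mapsto T_{ba}^{\{1\}}$. Let $L_{(1,0)}=\mathbb C^2$ be the irreducible $\mathfrak{gl}_2$-module of highest weight $(1,0)$, and $L_{(1,0)}(0)$ the evaluation $Y(\mathfrak{gl}_2)$-module on it, where $T_{ab}(u)$ acts as $\delta_{ab}+u^{-1}e_{ba}$. Let $L_{\boldsymbol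 1}(\boldsymbol 0)=L_{(1,0)}(0)^{\otimes n}$ be the $n$-fold tensor product of $Y(\mathfrak{gl}_2)$-modules, and $\mathrm{Sing}\,L_{\boldsymbol 1}[l]=\{p\in L_{\boldsymbol 1}(\boldsymbol 0)\mid e_{12}p=0,\ e_{22}p=lp\}$. The coefficients of the series $T_{11}(u)+T_{22}(u)$ commute with each other and with $\mathfrak{gl}_2$, hence preserve $\mathrm{Sing}\,L_{\boldsymbol 1}[l]$. The Bethe algebra $A_L$ is the unital subalgebra of $\mathrm{End}(\mathrm{Sing}\,L_{\boldsymbol 1}[l])$ generated by the coefficients of $\bigl(T_{11}(u)+T_{22}(u)\bigr)\big|_{\mathrm{Sing}\,L_{\boldsymbol 1}[l]}$. ''Simple spectrum'' means that all (joint) eigenspaces of the commutative algebra $A_L$ in $\mathrm{Sing}\,L_{\boldsymbol 1}[l]$ are one-dimensional. *)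

(* Defs.v *)
From HB Require Import structures.
From mathcomp Require Import all_boot all_order all_algebra.
From mathcomp Require Import mxtens.

Set Implicit Arguments.
Unset Strict Implicit.
Unset Printing Implicit Defensive.

Import GRing.Theory.
Local Open Scope ring_scope.

(* Indices 1, 2 of gl_2 are 0, 1 : 'I_2. *)
Definition i1 : 'I_2 := ord0.
Definition i2 : 'I_2 := ord_max.

Section Relations.
Variables (F : fieldType) (d : nat).

(* [T a b s] is T_ab^{s}, with T_ab^{0} = delta_ab the constant term of T_ab(u).
   [yangian_rel] is the coefficient of u^-r v^-s in
     (u - v) [T_ab(u), T_cd(v)] = T_cb(v) T_ad(u) - T_cb(u) T_ad(v);
   the coefficients with a positive power of u or v vanish on both sides, as
   T_ab^{0} is scalar.  (The index d is called e, d being the dimension.) *)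
Definition yangian_unit (T : 'I_2 -> 'I_2 -> nat -> 'M[F]_d) :=
  forall a b, T a b 0 = (a == b)%:R%:M.

Definition yangian_rel (T : 'I_2 -> 'I_2 -> nat -> 'M[F]_d) :=
  forall a b c e r s,
    (T a b r.+1 *m T c e s - T c e s *m T a b r.+1)
    - (T a b r *m T c e s.+1 - T c e s.+1 *m T a b r)
    = T c b s *m T a e r - T c b r *m T a e s.

End Relations.

(* A finite-dimensional Y(gl_2)-module: the space 'cV[F]_(ydim V), on which the
   generators act by left multiplication.  As Y(gl_2) is given by generators and
   relations, a module is a family of operators satisfying the relations. *)
Record yangian_module (F : fieldType) := YangianModule {
  ydim : nat;
  yT : 'I_2 -> 'I_2 -> nat -> 'M[F]_ydim;
  yT_unit : yangian_unit yT;
  yT_rel : yangian_rel yT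
}.

Section Vector.
Variable F : fieldType.

(* e_ab acts on C^2 as the matrix unit E_ab, so e_ba is [delta_mx b a]. *)
Definition vect_T (a b : 'I_2) (s : nat) : 'M[F]_2 :=
  match s with
  | 0 => (a == b)%:R%:M
  | 1 => delta_mx b a
  | _ => 0
  end.

Fact vect_T_unit : yangian_unit vect_T.
Proof. by []. Qed.

Fact vect_T_rel : yangian_rel vect_T.
Proof.
have dE (a b c e : 'I_2) :
  delta_mx b a *m delta_mx e c = (a == e)%:R *: delta_mx b c :> 'M[F]_2.
  case: (eqVneq a e) => [->|ae]; first by rewrite mul_delta_mx scale1r.
  by rewrite mul_delta_mx_0 // scale0r.
move=> a b c e [|[|r]] [|[|s]] /=;
  rewrite ?mul0mx ?mulmx0 ?mul_scalar_mx ?mul_mx_scalar ?dE ?subrr ?subr0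
          ?sub0r ?oppr0 ?scaler0 ?subrr //.
by rewrite opprB.
Qed.

(* The evaluation module L_(1,0)(0). *)
Definition yvect := YangianModule vect_T_unit vect_T_rel.

End Vector.

Section Tensor.
Variable F : fieldType.

Fact tensmxDl m n p q (A A' : 'M[F]_(m, n)) (B : 'M[F]_(p, q)) :
  (A + A') *t B = A *t B + A' *t B.
Proof. by apply/matrixP=> i j; rewrite !mxE mulrDl. Qed.

Fact tensmxDr m n p q (A : 'M[F]_(m, n)) (B B' : 'M[F]_(p, q)) :
  A *t (B + B') = A *t B + A *t B'.
Proof. by apply/matrixP=> i j; rewrite !mxE mulrDr. Qed.

Fact tensmxNl m n p q (A : 'M[F]_(m, n)) (B : 'M[F]_(p, q)) :
  (- A) *t B = - (A *t B).
Proof. by apply/matrixP=> i j; rewrite !mxE mulNr. Qed.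

Fact tensmxNr m n p q (A : 'M[F]_(m, n)) (B : 'M[F]_(p, q)) :
  A *t (- B) = - (A *t B).
Proof. by apply/matrixP=> i j; rewrite !mxE mulrN. Qed.

Fact tensmx_suml m n p q I (r : seq I) (A : I -> 'M[F]_(m, n))
    (B : 'M[F]_(p, q)) :
  (\sum_(i <- r) A i) *t B = \sum_(i <- r) (A i *t B).
Proof.
by elim/big_rec2: _ => [|i y1 y2 _ <-]; rewrite ?tens0mx ?tensmxDl.
Qed.

Fact tensmx_sumr m n p q I (r : seq I) (A : 'M[F]_(m, n))
    (B : I -> 'M[F]_(p, q)) :
  A *t (\sum_(i <- r) B i) = \sum_(i <- r) (A *t B i).
Proof.
by elim/big_rec2: _ => [|i y1 y2 _ <-]; rewrite ?tensmx0 ?tensmxDr.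
Qed.

Fact tens_scalar_scalar m n (x y : F) :
  (x%:M : 'M_m) *t (y%:M : 'M_n) = (x * y)%:M.
Proof.
apply/matrixP=> i j.
case: (mxtens_indexP i)=> i0 i'; case: (mxtens_indexP j)=> j0 j'.
rewrite tensmxE !mxE (can_eq (@mxtens_indexK _ _)) xpair_eqE.
by case: eqP; case: eqP; rewrite /= ?mulr0n ?mulr1n ?mul0r ?mulr0.
Qed.

(* Series in x = u^-1 and y = v^-1 are coefficient families [nat -> nat -> 'M_d];
   [shx], [shy] multiply by x, y. *)
Definition shx d (G : nat -> nat -> 'M[F]_d) r s :=
  if r is r'.+1 then G r' s else 0.
Definition shy d (G : nat -> nat -> 'M[F]_d) r s :=
  if s is s'.+1 then G r s' else 0.

Definition conv d1 d2 (G : nat -> nat -> 'M[F]_d1) (H : nat -> nat -> 'M[F]_d2)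
    r s : 'M[F]_(d1 * d2) :=
  \sum_(i < r.+1) \sum_(j < s.+1) (G i j *t H (r - i)%N (s - j)%N).

Section Conv.
Variables d1 d2 : nat.
Implicit Types (G : nat -> nat -> 'M[F]_d1) (H : nat -> nat -> 'M[F]_d2).

Fact conv_shxl G H r s : conv (shx G) H r s = shx (conv G H) r s.
Proof.
rewrite /conv big_ord_recl /= big1 ?add0r => [|j _]; last by rewrite tens0mx.
by case: r => [|r]; [rewrite big_ord0 | apply: eq_bigr].
Qed.

Fact conv_shyl G H r s : conv (shy G) H r s = shy (conv G H) r s.
Proof.
rewrite /conv; case: s => [|s] /=.
  by apply: big1 => i _; rewrite big_ord1 tens0mx.
by apply: eq_bigr => i _; rewrite big_ord_recl tens0mx add0r.
Qed.

Fact conv_shxr G H r s : conv G (shx H) r s = shx (conv G H) r s.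
Proof.
rewrite /conv; case: r => [|r] /=.
  by rewrite big_ord1 /= big1 // => j _; rewrite tensmx0.
rewrite big_ord_recr /= subnn [X in _ + X]big1 ?addr0 => [|j _].
  by apply: eq_bigr => i _; apply: eq_bigr => j _; rewrite subSn // -ltnS.
by rewrite tensmx0.
Qed.

Fact conv_shyr G H r s : conv G (shy H) r s = shy (conv G H) r s.
Proof.
rewrite /conv; case: s => [|s] /=.
  by apply: big1 => i _; rewrite big_ord1 tensmx0.
apply: eq_bigr => i _; rewrite big_ord_recr /= subnn tensmx0 addr0.
by apply: eq_bigr => j _; rewrite subSn // -ltnS.
Qed.

End Conv.

Definition shD d (G : nat -> nat -> 'M[F]_d) r s := shy G r s - shx G r s.
Definition shM d (G : nat -> nat -> 'M[F]_d) := shx (shy G).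

Fact eq_conv d1 d2 (G G' : nat -> nat -> 'M[F]_d1)
    (H H' : nat -> nat -> 'M[F]_d2) r s :
  G =2 G' -> H =2 H' -> conv G H r s = conv G' H' r s.
Proof.
move=> eG eH; apply: eq_bigr => i _; apply: eq_bigr => j _.
by rewrite eG eH.
Qed.

Fact convDl d1 d2 (G G' : nat -> nat -> 'M[F]_d1) (H : nat -> nat -> 'M[F]_d2)
    r s :
  conv (fun i j => G i j + G' i j) H r s = conv G H r s + conv G' H r s.
Proof.
rewrite /conv -big_split; apply: eq_bigr => i _ /=.
by rewrite -big_split; apply: eq_bigr => j _ /=; rewrite tensmxDl.
Qed.

Fact convDr d1 d2 (G : nat -> nat -> 'M[F]_d1) (H H' : nat -> nat -> 'M[F]_d2)
    r s :
  conv G (fun i j => H i j + H' i j) r s = conv G H r s + conv G H' r s.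
Proof.
rewrite /conv -big_split; apply: eq_bigr => i _ /=.
by rewrite -big_split; apply: eq_bigr => j _ /=; rewrite tensmxDr.
Qed.

Fact convNl d1 d2 (G : nat -> nat -> 'M[F]_d1) (H : nat -> nat -> 'M[F]_d2) r s :
  conv (fun i j => - G i j) H r s = - conv G H r s.
Proof.
rewrite /conv -sumrN; apply: eq_bigr => i _; rewrite -sumrN.
by apply: eq_bigr => j _; rewrite tensmxNl.
Qed.

Fact convNr d1 d2 (G : nat -> nat -> 'M[F]_d1) (H : nat -> nat -> 'M[F]_d2) r s :
  conv G (fun i j => - H i j) r s = - conv G H r s.
Proof.
rewrite /conv -sumrN; apply: eq_bigr => i _; rewrite -sumrN.
by apply: eq_bigr => j _; rewrite tensmxNr.
Qed.

Fact conv_shDl d1 d2 (G : nat -> nat -> 'M[F]_d1) (H : nat -> nat -> 'M[F]_d2)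
    r s :
  conv (shD G) H r s = shD (conv G H) r s.
Proof. by rewrite convDl convNl conv_shxl conv_shyl. Qed.

Fact conv_shDr d1 d2 (G : nat -> nat -> 'M[F]_d1) (H : nat -> nat -> 'M[F]_d2)
    r s :
  conv G (shD H) r s = shD (conv G H) r s.
Proof. by rewrite convDr convNr conv_shxr conv_shyr. Qed.

Fact conv_shMl d1 d2 (G : nat -> nat -> 'M[F]_d1) (H : nat -> nat -> 'M[F]_d2)
    r s :
  conv (shM G) H r s = shM (conv G H) r s.
Proof. by rewrite conv_shxl; case: r => //= r; rewrite conv_shyl. Qed.

Fact conv_shMr d1 d2 (G : nat -> nat -> 'M[F]_d1) (H : nat -> nat -> 'M[F]_d2)
    r s :
  conv G (shM H) r s = shM (conv G H) r s.
Proof. by rewrite conv_shxr; case: r => //= r; rewrite conv_shyr. Qed.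

Fact shD_sum d I (t : seq I) (G : I -> nat -> nat -> 'M[F]_d) r s :
  shD (fun i j => \sum_(k <- t) G k i j) r s = \sum_(k <- t) shD (G k) r s.
Proof.
rewrite /shD /shx /shy sumrB.
by case: r s => [|r] [|s]; rewrite // !big1_eq.
Qed.

Fact shM_sum d I (t : seq I) (G : I -> nat -> nat -> 'M[F]_d) r s :
  shM (fun i j => \sum_(k <- t) G k i j) r s = \sum_(k <- t) shM (G k) r s.
Proof. by rewrite /shM /shx /shy; case: r s => [|r] [|s]; rewrite ?big1_eq. Qed.

Fact eq_shD d (G H : nat -> nat -> 'M[F]_d) : G =2 H -> shD G =2 shD H.
Proof. by move=> e [|r] [|s]; rewrite /shD /= ?e. Qed.

Fact eq_shM d (G H : nat -> nat -> 'M[F]_d) : G =2 H -> shM G =2 shM H.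
Proof. by move=> e [|r] [|s]; rewrite /shM /= ?e. Qed.

Section Products.
Variables (d : nat) (T : 'I_2 -> 'I_2 -> nat -> 'M[F]_d).

(* Coefficients of T_ab(u) T_ce(v) and of T_ce(v) T_ab(u). *)
Definition prodL a b c e r s := T a b r *m T c e s.
Definition prodR a b c e r s := T c e s *m T a b r.

Fact yangian_relP : yangian_unit T ->
  yangian_rel T <->
  (forall a b c e r s,
     shD (prodL a b c e) r s + shM (prodL c b a e) r s =
     shD (prodR a b c e) r s + shM (prodR a e c b) r s).
Proof.
have alg (U : zmodType) (p q p' q' x y : U) :
  (p - p' - (q - q') = x - y) <-> (p - q + y = p' - q' + x).
  suff e : p - p' - (q - q') - (x - y) = p - q + y - (p' - q' + x).
    split=> h; apply/eqP; rewrite -subr_eq0.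
      by rewrite -e h subrr.
    by rewrite e h subrr.
  by rewrite !opprB opprD opprB !addrA [LHS](ACl (1*4*5*3*2*6)).
move=> T0; split=> [h a b c e [|r] [|s]|h a b c e r s].
- by [].
- by rewrite /shD /shM /shx /shy /= !subr0 !addr0 /prodL /prodR T0 scalar_mxC.
- by rewrite /shD /shM /shx /shy /= !sub0r !addr0 /prodL /prodR T0 scalar_mxC.
- by apply/alg; apply: h.
- by apply/alg; apply: (h a b c e r.+1 s.+1).
Qed.

End Products.

Section TensorModule.
Variables V W : yangian_module F.

(* The action through the coproduct
     Delta : T_ab(u) |-> sum_c T_cb(u) (x) T_ac(u). *)
Definition tens_T (a b : 'I_2) (s : nat) : 'M[F]_(ydim V * ydim W) :=
  \sum_(c : 'I_2) \sum_(i < s.+1) (yT V c b i *t yT W a c (s - i)%N).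

Fact tens_T_unit : yangian_unit tens_T.
Proof.
move=> a b; rewrite /tens_T.
under eq_bigr => c _ do rewrite big_ord1 /= !yT_unit.
rewrite (bigD1 b) //= big1 ?addr0 => [|c /negPf cb]; last first.
  by rewrite cb raddf0 tens0mx.
by rewrite eqxx tens_scalar_scalar mul1r.
Qed.

Fact tens_prodL a b c e r s :
  prodL tens_T a b c e r s =
  \sum_(p : 'I_2 * 'I_2)
     conv (prodL (yT V) p.1 b p.2 e) (prodL (yT W) a p.1 c p.2) r s.
Proof.
rewrite /prodL /tens_T mulmx_suml -(pair_bigA _ (fun p q =>
  conv (fun i j => yT V p b i *m yT V q e j)
       (fun i j => yT W a p i *m yT W c q j) r s)) /=.
apply: eq_bigr => p _; rewrite mulmx_sumr; apply: eq_bigr => q _.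
rewrite mulmx_suml; apply: eq_bigr => i _; rewrite mulmx_sumr.
by apply: eq_bigr => j _; rewrite tensmx_mul.
Qed.

Fact tens_prodR a b c e r s :
  prodR tens_T a b c e r s =
  \sum_(p : 'I_2 * 'I_2)
     conv (prodR (yT V) p.1 b p.2 e) (prodR (yT W) a p.1 c p.2) r s.
Proof.
rewrite /prodR /tens_T mulmx_sumr -(pair_bigA _ (fun p q =>
  conv (fun i j => yT V q e j *m yT V p b i)
       (fun i j => yT W c q j *m yT W a p i) r s)) /=.
apply: eq_bigr => p _; rewrite mulmx_suml; apply: eq_bigr => q _.
rewrite mulmx_sumr; apply: eq_bigr => i _; rewrite mulmx_suml.
by apply: eq_bigr => j _; rewrite tensmx_mul.
Qed.

Fact tens_T_rel : yangian_rel tens_T.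
Proof.
apply/(yangian_relP tens_T_unit) => a b c e r s.
have hV := (yangian_relP (@yT_unit _ V)).1 (@yT_rel _ V).
have hW := (yangian_relP (@yT_unit _ W)).1 (@yT_rel _ W).
rewrite !(eq_shD (tens_prodL _ _ _ _)) !(eq_shM (tens_prodL _ _ _ _)).
rewrite !(eq_shD (tens_prodR _ _ _ _)) !(eq_shM (tens_prodR _ _ _ _)).
rewrite !shD_sum !shM_sum -!big_split /=.
pose A := prodL (yT V); pose A' := prodR (yT V); pose B' := prodR (yT W).
transitivity (\sum_(p : 'I_2 * 'I_2)
    (conv (shD (A p.1 b p.2 e)) (B' a p.1 c p.2) r s
     + conv (shM (A p.1 b p.2 e)) (B' a p.2 c p.1) r s)).
  apply: eq_bigr => p _.
  rewrite -conv_shDr -conv_shMr -convDr (eq_conv _ _ (fun _ _ => erefl) (hW _ _ _ _)).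
  by rewrite convDr conv_shDr conv_shMr conv_shDl conv_shMl.
have sw (G : 'I_2 -> 'I_2 -> 'M[F]_(ydim V * ydim W)) :
    \sum_(p : 'I_2 * 'I_2) G p.1 p.2 = \sum_(p : 'I_2 * 'I_2) G p.2 p.1.
  by rewrite -!(pair_bigA _ G) exchange_big (pair_bigA _ (fun x y => G y x)).
rewrite big_split /=.
rewrite (sw (fun x y => conv (shM (A x b y e)) (B' a y c x) r s)) -big_split /=.
apply: eq_bigr => p _.
rewrite -convDl (eq_conv _ _ (hV _ _ _ _) (fun _ _ => erefl)).
by rewrite convDl conv_shDl conv_shMl.
Qed.

Definition ytens := YangianModule tens_T_unit tens_T_rel.

End TensorModule.
End Tensor.

Section Spectrum.
Variables (F : fieldType) (V : vectType F).

(* The unital subalgebra of End(V) generated by [gen]. *)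
Inductive subalgebra_gen (gen : 'End(V) -> Prop) : 'End(V) -> Prop :=
  | subalgebra_gen_in f : gen f -> subalgebra_gen gen f
  | subalgebra_gen_1 : subalgebra_gen gen \1%VF
  | subalgebra_gen_lin k f g : subalgebra_gen gen f -> subalgebra_gen gen g ->
      subalgebra_gen gen (k *: f + g)
  | subalgebra_gen_comp f g : subalgebra_gen gen f -> subalgebra_gen gen g ->
      subalgebra_gen gen (f \o g)%VF.

(* The values of [chi] outside [A] are irrelevant. *)
Definition joint_eigenspace (A : 'End(V) -> Prop) (chi : 'End(V) -> F)
    (v : V) : Prop :=
  forall f, A f -> f v = chi f *: v.

Definition one_dimensional (E : V -> Prop) : Prop :=
  exists2 L : {vspace V}, \dim L = 1 & forall v, E v <-> v \in L.

Definition simple_spectrum (A : 'End(V) -> Prop) : Prop :=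
  forall chi : 'End(V) -> F,
    (exists2 v, v != 0 & joint_eigenspace A chi v) ->
    one_dimensional (joint_eigenspace A chi).

End Spectrum.

Section Bethe.
Variables (F : fieldType) (V : yangian_module F) (l : nat).

(* U(gl_2) acts through e_ab |-> T_ba^{1}. *)
Definition gl_act (a b : 'I_2) : 'M[F]_(ydim V) := yT V b a 1.

Definition sing : {vspace 'cV[F]_(ydim V)} :=
  (lker (linfun (mulmx (gl_act i1 i2))) :&:
   lker (linfun (mulmx (gl_act i2 i2)) - l%:R *: \1%VF))%VS.

Fact singP (p : 'cV[F]_(ydim V)) :
  reflect (gl_act i1 i2 *m p = 0 /\ gl_act i2 i2 *m p = l%:R *: p) (p \in sing).
Proof.
rewrite memv_cap !memv_ker add_lfunE opp_lfunE scale_lfunE id_lfunE !lfunE /=.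
by rewrite subr_eq0; apply: (iffP andP) => -[/eqP ? /eqP ?].
Qed.

(* The coefficient of u^-s in T_11(u) + T_22(u). *)
Definition transfer (s : nat) : 'M[F]_(ydim V) := yT V i1 i1 s + yT V i2 i2 s.

Fact transfer_gl_comm a b s :
  gl_act a b *m transfer s = transfer s *m gl_act a b.
Proof.
have h c := @yT_rel _ V b a c c 0 s.
apply/eqP; rewrite -subr_eq0 /gl_act /transfer mulmxDr mulmxDl opprD addrACA.
have {}h c : yT V b a 1 *m yT V c c s - yT V c c s *m yT V b a 1
    = (b == c)%:R *: yT V c a s - (c == a)%:R *: yT V b c s.
  have := h c; rewrite !yT_unit !mul_scalar_mx !mul_mx_scalar subrr subr0.
  by [].
have i12 (x : 'I_2) : x = i1 \/ x = i2.
  by case: x => [[|[|x]] hx] //; [left | right]; apply: val_inj.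
rewrite !h; case: (i12 a) => ->; case: (i12 b) => ->;
  by rewrite ?eqxx /= ?scale0r ?scale1r ?subr0 ?sub0r ?subrr ?add0r ?addr0
             ?subrr ?addNr.
Qed.

Fact transfer_sing s (p : 'cV[F]_(ydim V)) :
  p \in sing -> transfer s *m p \in sing.
Proof.
move=> /singP[p12 p22]; apply/singP.
by rewrite !mulmxA !transfer_gl_comm -!mulmxA p12 p22 mulmx0 -scalemxAr.
Qed.

(* [vsproj] only casts the invariant subspace, see [transfer_onE]. *)
Definition transfer_on (s : nat) : 'End(subvs_of sing) :=
  linfun (vsproj sing \o mulmx (transfer s) \o vsval).

Fact transfer_onE s (p : subvs_of sing) :
  vsval (transfer_on s p) = transfer s *m vsval p.
Proof. by rewrite lfunE /= vsprojK // transfer_sing ?subvsP. Qed.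

Definition bethe_algebra : 'End(subvs_of sing) -> Prop :=
  subalgebra_gen (fun f => exists s, f = transfer_on s).

End Bethe.

Arguments bethe_algebra {F} V l _.

(* L_(1,0)(0)^{(x) n}, for n >= 1, bracketed to the right. *)
Definition L_one (F : fieldType) (n : nat) : yangian_module F :=
  iter n.-1 (ytens (yvect F)) (yvect F).

(* Main.v *)
Require Import Defs.
From mathcomp Require Import all_boot all_order all_algebra.
From mathcomp Require Import reals complex.
From mathcomp Require Import mxtens zify ring.

Set Implicit Arguments.
Unset Strict Implicit.
Unset Printing Implicit Defensive.

Import GRing.Theory.
Local Open Scope ring_scope.

(** Write C_k, H_k, t_k for the coefficients of u^-k in T_21(u),
    T_11(u) - T_22(u) and T_11(u) + T_22(u).  A vector p of weight (n-l, l) is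
    singular when C_1 p = 0.  The idea is to exhibit a linear form on the
    singular vectors that vanishes on no joint eigenvector of the t_k.  Then two
    joint eigenvectors for the same character have a nonzero combination killed
    by the form as soon as they are independent, which is absurd, so every joint
    eigenspace is a line.

    The form is phi(p) = <0| C_2^l p, where <0| is the covector dual to the
    vector of highest weight.  For l = 1 it is p |-> sum_k (k-1) p_k, with
    p_k the coordinate of p for the one lowered spin at site k.

    The words <0| C_s1 ... C_sr span all covectors ([L_one_generated]), and only
    those of length l see the weight (n-l, l).  It therefore suffices that an
    eigenvector p with phi(p) = 0 is killed by every word s of length l
    ([word_eigen_eq0]).  This is an induction on s: first on the sum of s,
    upwards, then on the sum of the squares of its entries, downwards.  The C_k
    commute, so an entry 1 kills p because C_1 p = 0, and an entry 0 gives 0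
    because C_0 = 0.  If all entries are 2, the word is phi.  Otherwise, up to
    order, s = m :: b ++ 2^r with m > 2 and all entries of b greater than 2.
    Apply the word s' = b ++ 2^(r+1), of smaller sum, to t_m p, which is a
    multiple of p: the result is 0 by induction.  On the other hand t_m can be
    moved to the left until it meets <0|, on which it is a scalar.  Crossing one
    of the r+1 last factors C_2 yields the word s times -(n - 2j), where j is
    the number of factors that stand on its left ([word_twos_transfer]).
    Crossing the factors of b only yields words of smaller sum, and words with
    the same sum as s and a larger sum of squares ([word_transfer_eq0]).  All
    these, and the multiple of s' left at the end, vanish by induction, so that
    (sum_j (n - 2j)) s kills p, with j < l throughout.  As 2l <= n every n - 2j
    is positive, hence s kills p. *)

(** * Commutation relations for the raising and transfer operators *)

Section Commutators.
Variables (F : fieldType) (V : yangian_module F).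

(** T_21^{1} acts as the raising operator e_12 of gl_2, hence the name. *)
Definition raise s := yT V i2 i1 s.
Definition cartan s := yT V i1 i1 s - yT V i2 i2 s.

(** The defining relation telescopes.  It can be summed in either direction,
    towards r = 0 or towards s = 0, and this gives the bound [minn r s]. *)
Lemma yangian_comm a b c e r s :
  yT V a b r *m yT V c e s - yT V c e s *m yT V a b r =
  \sum_(i < minn r s) (yT V c b (r + s - i.+1) *m yT V a e i
                       - yT V c b i *m yT V a e (r + s - i.+1)).
Proof.
pose X r s := yT V a b r *m yT V c e s - yT V c e s *m yT V a b r.
pose G i j := yT V c b j *m yT V a e i - yT V c b i *m yT V a e j.
have X0 k : X 0%N k = 0 by rewrite /X yT_unit scalar_mxC subrr.
have X0r k : X k 0%N = 0 by rewrite /X yT_unit scalar_mxC subrr.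
have step p q : X p.+1 q = X p q.+1 + G p q.
  by apply/eqP; rewrite addrC -subr_eq; apply/eqP; apply: yT_rel.
rewrite -/(X r s) -[RHS](_ : \sum_(i < minn r s) G i (r + s - i.+1)%N = _) //.
(* Shift the index from r to s, or from s to r, until the bracket vanishes. *)
case: (leqP r s) => _.
  elim: r s => [|r IH] s; first by rewrite big_ord0 X0.
  rewrite step IH big_ord_recr /= addSnnS; congr (_ + G r _); lia.
elim: s r => [|s IH] r; first by rewrite big_ord0 X0r.
have -> : X r s.+1 = X r.+1 s - G r s by rewrite step addrK.
rewrite IH big_ord_recr /= addSnnS; congr (_ + _).
by rewrite (_ : (r + s.+1 - s.+1)%N = r) /G ?opprB; last lia.
Qed.

Lemma raise0 : raise 0 = 0.
Proof. by rewrite /raise yT_unit raddf0. Qed.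

Lemma cartan0 : cartan 0 = 0.
Proof. by rewrite /cartan !yT_unit subrr. Qed.

Lemma transfer0 : transfer V 0 = 2%:R%:M.
Proof. by rewrite /transfer !yT_unit -raddfD. Qed.

Lemma raiseC r s : raise r *m raise s = raise s *m raise r.
Proof.
apply/eqP; rewrite -subr_eq0; apply/eqP; elim: r s => [|r IH] s.
  by rewrite raise0 mul0mx mulmx0 subrr.
have /eqP := @yT_rel _ V i2 i1 i2 i1 r s.
rewrite -/(raise _) -/(raise _) -/(raise _) -/(raise _) -(opprB _ (raise s *m _)) IH.
by rewrite IH subr0 oppr0 => /eqP.
Qed.

Lemma raise_transferC k m :
  raise k *m transfer V m = transfer V m *m raise k
  + \sum_(i < minn k m) (cartan (k + m - i.+1) *m raise i
                         - cartan i *m raise (k + m - i.+1)).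
Proof.
have h1 := yangian_comm i2 i1 i1 i1 k m.
have h2 := yangian_comm i2 i2 i2 i1 m k.
rewrite minnC [(m + k)%N]addnC in h2.
apply/eqP; rewrite addrC -subr_eq; apply/eqP.
rewrite /transfer /cartan mulmxDr mulmxDl opprD addrACA h1 -[X in _ + X]opprB h2.
rewrite -sumrB; apply: eq_bigr => i _.
by rewrite !mulmxBl !opprB addrACA [RHS]addrACA [- _ - _]addrC.
Qed.

Lemma raise_cartanC k a :
  raise k *m cartan a = cartan a *m raise k
  + \sum_(i < minn k a) (transfer V (k + a - i.+1) *m raise i
                         - transfer V i *m raise (k + a - i.+1)).
Proof.
have h1 := yangian_comm i2 i1 i1 i1 k a.
have h2 := yangian_comm i2 i2 i2 i1 a k.
rewrite minnC [(a + k)%N]addnC in h2.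
apply/eqP; rewrite addrC -subr_eq; apply/eqP.
rewrite /transfer /cartan mulmxBr mulmxBl opprD addrACA h1 opprK.
rewrite [X in _ + X]addrC h2.
rewrite -big_split; apply: eq_bigr => i _ /=.
by rewrite !mulmxDl opprD addrACA.
Qed.

Lemma raise_e22C k :
  raise k *m yT V i2 i2 1 = yT V i2 i2 1 *m raise k + raise k.
Proof.
have := yangian_comm i2 i2 i2 i1 1 k; rewrite -/(raise k).
case: k => [|k]; first by rewrite raise0 !mulmx0 !mul0mx !addr0.
rewrite (minn_idPl _) // big_ord1 -/(raise _) raise0 mulmx0 sub0r yT_unit mul1mx.
rewrite subn1 => /eqP; rewrite subr_eq addrC => /eqP ->.
by rewrite subrK.
Qed.

End Commutators.

(** * Words of raising operators applied to a highest covector *)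

(** The dual notion of a highest weight vector: T_11(u) acts on the right by a
    scalar series, T_22(u) by 1 and T_12(u) by 0. *)
Definition highest_covector (F : fieldType) (V : yangian_module F)
    (w : 'rV[F]_(ydim V)) (mu : F) :=
  [/\ forall s, w *m yT V i1 i2 s = 0,
      forall s, w *m yT V i2 i2 s = (s == 0)%:R *: w,
      forall s, exists c, w *m yT V i1 i1 s = c *: w
    & w *m yT V i1 i1 1 = mu *: w].

Section Words.
Variables (F : fieldType) (V : yangian_module F).
Variables (w0 : 'rV[F]_(ydim V)) (mu : F).
Hypothesis w0_highest : highest_covector w0 mu.
Implicit Types (s b : seq nat) (v : 'cV[F]_(ydim V)).

Definition word s := foldl (fun x k => x *m raise V k) w0 s.

Lemma word_rcons s k : word (rcons s k) = word s *m raise V k.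
Proof. exact: foldl_rcons. Qed.

Lemma word_mid s k t : word (s ++ k :: t) = word (s ++ t) *m raise V k.
Proof.
elim/last_ind: t => [|t j IH]; first by rewrite cats1 cats0 word_rcons.
by rewrite -rcons_cons -!rcons_cat !word_rcons IH -!mulmxA raiseC.
Qed.

Lemma perm_word s t : perm_eq s t -> word s = word t.
Proof.
elim/last_ind: s t => [|s k IH] t; first by rewrite perm_sym => /perm_nilP->.
move=> st; have /splitPr et : k \in t by rewrite -(perm_mem st) mem_rcons mem_head.
case: et st => t1 t2; rewrite perm_rcons perm_sym.
rewrite (perm_catCA t1 [:: k] t2) perm_cons => h.
by rewrite word_rcons word_mid (IH (t1 ++ t2)) // perm_sym.
Qed.

Lemma word_e22 s : word s *m yT V i2 i2 1 = (size s)%:R *: word s.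
Proof.
elim/last_ind: s => [|s k IH]; first by case: w0_highest => _ ->.
rewrite word_rcons size_rcons -mulmxA raise_e22C mulmxDr mulmxA IH.
by rewrite -scalemxAl -natr1 scalerDl scale1r.
Qed.

Lemma word_cartan1 s : word s *m cartan V 1 = (mu - (2 * size s)%:R) *: word s.
Proof.
elim/last_ind: s => [|s k IH].
  case: w0_highest => _ h22 _ h11.
  by rewrite /cartan mulmxBr h11 h22 scale0r !subr0.
rewrite word_rcons size_rcons -mulmxA raise_cartanC mulmxDr mulmxA IH.
case: k => [|k]; first by rewrite raise0 !mulmx0 min0n big_ord0 mulmx0 addr0 scaler0.
rewrite (minn_idPr _) // big_ord1 raise0 mulmx0 sub0r transfer0 addnK.
rewrite mul_scalar_mx mulmxN -scalemxAr -scalemxAl -scalerBl.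
by congr (_ *: _); ring.
Qed.

(** * The action of the transfer operators on words *)

(** The covectors vanishing on all v with [killed r d v] form the span of the
    words of length r and sum at most d; quantifying over such v expresses
    membership in this filtration by vanishing alone. *)
Definition killed r d v :=
  forall s, size s = r -> (sumn s <= d)%N -> word s *m v = 0.

Lemma killed_raise r d k v :
  killed r.+1 (d + k) v -> killed r d (raise V k *m v).
Proof.
move=> kv s sr sd; rewrite mulmxA -word_rcons kv ?size_rcons ?sr //.
by rewrite sumn_rcons leq_add2r.
Qed.

Lemma killed_le r d d' v : (d' <= d)%N -> killed r d v -> killed r d' v.
Proof. by move=> dd kv s sr sd; apply: kv => //; apply: leq_trans dd. Qed.

(** H_a raises the filtration degree by at most a - 1, and t_m by at most m - 2.
    The two claims need each other, since commuting H past C produces t, and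
    conversely. *)
Lemma word_act_filtered s :
  (forall a d v, killed (size s) d v -> (sumn s + a.-1 <= d)%N ->
     word s *m cartan V a *m v = 0) /\
  (forall m d v, killed (size s) d v -> (sumn s + (m - 2) <= d)%N ->
     word s *m transfer V m *m v = 0).
Proof.
elim/last_ind: s => [|s k [IHh IHt]].
  case: w0_highest => _ h22 h11 _; split=> a d v /(_ [::] erefl) kv ad.
    have [c hc] := h11 a; rewrite /= in kv.
    by rewrite /cartan mulmxBr /= hc h22 -scalerBl -scalemxAl kv ?scaler0.
  have [c hc] := h11 a; rewrite /= in kv.
  by rewrite /transfer mulmxDr /= hc h22 -scalerDl -scalemxAl kv ?scaler0.
rewrite size_rcons sumn_rcons word_rcons; split=> a d v kv ad.
  rewrite -(mulmxA (word s)) raise_cartanC mulmxDr mulmxDl.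
  rewrite !mulmxA -(mulmxA _ (raise V k)).
  rewrite (IHh _ (sumn s + a.-1)%N) // ?add0r; last first.
    by apply: killed_raise; apply: killed_le kv; lia.
  rewrite mulmx_sumr mulmx_suml big1 // => i _.
  rewrite mulmxBr mulmxBl !mulmxA -!(mulmxA _ (raise V _)).
  rewrite (IHt _ (d - i)%N) ?(IHt _ (d - (k + a - i.+1))%N) ?subrr //.
  - by apply: killed_raise; apply: killed_le kv; have := ltn_ord i; lia.
  - by have := ltn_ord i; lia.
  - by apply: killed_raise; apply: killed_le kv; have := ltn_ord i; lia.
  - by have := ltn_ord i; lia.
rewrite -(mulmxA (word s)) raise_transferC mulmxDr mulmxDl.
rewrite !mulmxA -(mulmxA _ (raise V k)).
rewrite (IHt _ (sumn s + (a - 2))%N) // ?add0r; last first.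
  by apply: killed_raise; apply: killed_le kv; lia.
rewrite mulmx_sumr mulmx_suml big1 // => -[[|i] ilt] _ /=.
  by rewrite cartan0 raise0 !mul0mx mulmx0 subrr mulmx0 mul0mx.
rewrite mulmxBr mulmxBl !mulmxA -!(mulmxA _ (raise V _)).
rewrite (IHh _ (d - i.+1)%N) ?(IHh _ (d - (k + a - i.+2))%N) ?subrr //.
- by apply: killed_raise; apply: killed_le kv; lia.
- by lia.
- by apply: killed_raise; apply: killed_le kv; lia.
- by lia.
Qed.

(** Modulo lower degree, H_a with a >= 2 acts on a word as a derivation that
    adds a - 1 to one entry at a time: in [C_k, H_a] the only term of top degree
    comes from the scalar t_0 = 2. *)
Lemma word_cartan_eq0 s a v :
  (2 <= a)%N -> killed (size s) (sumn s + a - 2) v ->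
  (forall s1 x s2, s = s1 ++ x :: s2 -> word (s1 ++ (x + a - 1)%N :: s2) *m v = 0) ->
  word s *m cartan V a *m v = 0.
Proof.
move=> a2; elim/last_ind: s v => [|s k IH] v kv zv.
  case: (word_act_filtered [::]) => h _; apply: (h a a.-1) => //=.
  by move=> t t0 _; apply: kv => //; case: t t0.
rewrite size_rcons sumn_rcons in kv.
rewrite word_rcons -(mulmxA (word s)) raise_cartanC mulmxDr mulmxDl !mulmxA.
rewrite -(mulmxA _ (raise V k)) IH ?add0r; last 2 first.
- by apply: killed_raise; apply: killed_le kv; lia.
- move=> s1 x s2 es; rewrite mulmxA -word_rcons rcons_cat rcons_cons.
  by apply: zv; rewrite es rcons_cat rcons_cons.
rewrite mulmx_sumr mulmx_suml big1 // => -[[|i] ilt] _ /=.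
  rewrite raise0 mulmx0 sub0r transfer0 mul_scalar_mx mulmxN -scalemxAr mulNmx.
  rewrite -scalemxAl -word_rcons -cats1 zv ?scaler0 ?oppr0 //.
  by rewrite cats1.
have [_ ht] := word_act_filtered s.
rewrite mulmxBr mulmxBl !mulmxA -!(mulmxA _ (raise V _)).
rewrite (ht _ (sumn s + k + a - 2 - i.+1)%N)
  ?(ht _ (sumn s + k + a - 2 - (k + a - i.+2))%N) ?subrr //.
- by apply: killed_raise; apply: killed_le kv; lia.
- by lia.
- by apply: killed_raise; apply: killed_le kv; lia.
- by lia.
Qed.

(** Redistributing the sum x + k + m - 2 into two entries, the third being 2,
    spreads the entries x, k, m apart, and the sum of squares is strictly
    convex.  This orders the terms produced when t_m crosses C_x ... C_k. *)
Lemma sq_spread x k m p : (2 < x)%N -> (1 < p)%N -> (p < k)%N -> (p < m)%N ->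
  (x * x + k * k + m * m
     < (x + (k + m - p.+1) - 1) * (x + (k + m - p.+1) - 1) + p * p + 4)%N /\
  (x * x + k * k + m * m
     < (x + p - 1) * (x + p - 1) + (k + m - p.+1) * (k + m - p.+1) + 4)%N.
Proof.
move=> x2 p1 pk pm.
wlog km : k m pk pm / (k <= m)%N.
  move=> h; case: (leqP k m) => [|/ltnW] km; first exact: h.
  rewrite addnAC [(k + m)%N]addnC; exact: h.
have [a ->] : exists a, x = (a + 3)%N by exists (x - 3)%N; lia.
have [t et] : exists t, p = t.+2 by exists (p - 2)%N; lia.
have [e ek] : exists e, k = (t + 3 + e)%N by exists (k - p.+1)%N; lia.
have [f em] : exists f, m = (k + f)%N by exists (m - k)%N; lia.
rewrite (_ : k + m - p.+1 = m + e)%N; last lia.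
rewrite (_ : a + 3 + (m + e) - 1 = a + 2 + m + e)%N; last lia.
rewrite (_ : a + 3 + p - 1 = a + t + 4)%N; last lia.
rewrite em ek et; split; nia.
Qed.

Definition sumsq s := sumn [seq (x * x)%N | x <- s].

Lemma sumsq_cons x s : sumsq (x :: s) = (x * x + sumsq s)%N.
Proof. by []. Qed.

Lemma sumsq_cat s t : sumsq (s ++ t) = (sumsq s + sumsq t)%N.
Proof. by rewrite /sumsq map_cat sumn_cat. Qed.

Lemma sumsq_le s : (sumsq s <= sumn s * sumn s)%N.
Proof. by elim: s => //= x s IH; rewrite sumsq_cons; nia. Qed.

(** Modulo lower degree, t_m acts on a word b by redistributing m and one or
    two of its entries.  The hypothesis on the sums of squares compares the
    outcome, completed by an entry 2, with b completed by m. *)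
Lemma word_transfer_eq0 b m v :
  (2 < m)%N -> all (leq 3) b -> raise V 1 *m v = 0 ->
  killed (size b) (sumn b + m - 3) v ->
  (forall s, size s = size b -> sumn s = (sumn b + m - 2)%N ->
     (sumsq b + m * m < sumsq s + 4)%N -> word s *m v = 0) ->
  word b *m transfer V m *m v = 0.
Proof.
move=> m2; elim/last_ind: b v => [|b k IH] v b3 v1 kv zv.
  case: (word_act_filtered [::]) => _ h; apply: (h m (m - 2)%N) => //=.
  by move=> t t0 _; apply: kv => //; case: t t0.
rewrite size_rcons sumn_rcons in kv zv.
move: b3; rewrite all_rcons => /andP[k3 b3].
have sqr j : sumsq (rcons b j) = (sumsq b + j * j)%N.
  by rewrite -cats1 sumsq_cat /sumsq /= addn0.
rewrite word_rcons -(mulmxA (word b)) raise_transferC mulmxDr mulmxDl !mulmxA.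
rewrite -(mulmxA _ (raise V k)) IH ?add0r //.
- rewrite mulmx_sumr mulmx_suml big1 // => -[[|[|i]] ilt] _ /=.
  + by rewrite cartan0 raise0 !mul0mx mulmx0 subrr mulmx0 mul0mx.
  (* H_1 is a scalar on words, so k becomes k + m - 2 and b is untouched. *)
  + rewrite mulmxBr mulmxBl !mulmxA word_cartan1 -(mulmxA _ _ v) v1 mulmx0 sub0r.
    rewrite -scalemxAl -word_rcons -scalemxAl zv ?scaler0 ?oppr0 ?size_rcons //.
    * by rewrite sumn_rcons; lia.
    * by rewrite !sqr; nia.
  (* H_i C_j and H_j C_i change an entry x of b as well: three entries vary. *)
  + rewrite mulmxBr mulmxBl !mulmxA -!(mulmxA _ (raise V _)).
    have {ilt} : (i.+2 < k)%N /\ (i.+2 < m)%N by lia.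
    move=> [ik im].
    have b_split s1 x s2 : b = s1 ++ x :: s2 ->
      [/\ (3 <= x)%N, size b = (size s1 + size s2).+1,
          sumn b = (sumn s1 + x + sumn s2)%N &
          sumsq b = (sumsq s1 + x * x + sumsq s2)%N].
      move=> eb; move: b3; rewrite eb all_cat /= => /and3P[_ -> _].
      by rewrite size_cat /= sumn_cat /= sumsq_cat /sumsq /= addnS !addnA.
    rewrite !word_cartan_eq0 ?subrr //.
    * by apply: killed_raise; apply: killed_le kv; lia.
    * move=> s1 x s2 /b_split[x3 sb nb qb].
      rewrite mulmxA -word_rcons; apply: zv.
      - by rewrite size_rcons size_cat /=; lia.
      - by rewrite sumn_rcons sumn_cat /=; lia.
      - have [sp1 sp2] := sq_spread x3 (isT : (1 < i.+2)%N) ik im.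
        rewrite sqr -cats1 !sumsq_cat qb /= !sumsq_cons. lia.
    * by lia.
    * by apply: killed_raise; apply: killed_le kv; lia.
    * move=> s1 x s2 /b_split[x3 sb nb qb].
      rewrite mulmxA -word_rcons; apply: zv.
      - by rewrite size_rcons size_cat /=; lia.
      - by rewrite sumn_rcons sumn_cat /=; lia.
      - have [sp1 sp2] := sq_spread x3 (isT : (1 < i.+2)%N) ik im.
        rewrite sqr -cats1 !sumsq_cat qb /= !sumsq_cons. lia.
- by rewrite mulmxA raiseC -mulmxA v1 mulmx0.
- by apply: killed_raise; apply: killed_le kv; lia.
- move=> s ss ns qs; rewrite mulmxA -word_rcons zv ?size_rcons ?ss //.
  + by rewrite sumn_rcons ns; lia.
  + rewrite sqr -cats1 sumsq_cat sumsq_cons; lia.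
Qed.

(** Against C_2 the commutator with t_m has two terms only, -H_1 C_m, which is a
    scalar times C_m on a word, and H_m C_1, which kills v. *)
Lemma word_twos_transfer b r m v :
  (2 < m)%N -> raise V 1 *m v = 0 ->
  word (b ++ nseq r.+1 2%N) *m transfer V m *m v =
  word b *m transfer V m *m iter r.+1 (mulmx (raise V 2)) v
  - (\sum_(k < r.+1) (mu - (2 * (size b + k))%:R))
    *: (word (m :: b ++ nseq r 2%N) *m v).
Proof.
move=> m2; have peel s u : raise V 1 *m u = 0 ->
    word (rcons s 2%N) *m transfer V m *m u =
    word s *m transfer V m *m (raise V 2 *m u)
    - (mu - (2 * size s)%:R) *: (word (m :: s) *m u).
  move=> u1; rewrite word_rcons -(mulmxA (word s)) raise_transferC.
  rewrite (minn_idPl _) 1?ltnW // big_ord_recl big_ord1 /= cartan0 raise0.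
  rewrite mulmx0 mul0mx subrr add0r mulmxDr mulmxDl !mulmxA; congr (_ + _).
  rewrite (_ : 2 + m - 2 = m)%N; last lia.
  rewrite mulmxBr mulmxBl !mulmxA -[X in X - _]mulmxA u1 mulmx0 sub0r.
  by rewrite word_cartan1 -!scalemxAl (word_mid [::]).
elim: r v => [|r IH] v v1.
  by rewrite cats1 peel // cats0 big_ord1 addn0.
have -> : b ++ nseq r.+2 2%N = rcons (b ++ nseq r.+1 2%N) 2%N.
  by rewrite -cats1 -catA -(nseqD r.+1 1) addn1.
rewrite peel // size_cat size_nseq IH; last first.
  by rewrite mulmxA raiseC -mulmxA v1 mulmx0.
rewrite -iterSr mulmxA -word_rcons.
rewrite (perm_word (s := rcons _ _) (t := m :: b ++ nseq r.+1 2%N)).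
  by rewrite -addrA -opprD -scalerDl [in RHS]big_ord_recr.
by rewrite perm_rcons -cat1s -!cat_cons perm_sym -[nseq r.+1 2%N]cat1s perm_catCA.
Qed.

(** The induction step solves, for the word s = m :: b ++ 2^r, the equation
    obtained by letting b ++ 2^(r+1) act on t_m v. *)
Lemma word_eigen_eq0 n l tau v :
  [pchar F] =i pred0 -> mu = n%:R -> (2 * l <= n)%N ->
  raise V 1 *m v = 0 -> (forall m, transfer V m *m v = tau m *: v) ->
  word (nseq l 2%N) *m v = 0 ->
  forall s, size s = l -> word s *m v = 0.
Proof.
move=> char0 emu ln v1 tv v2 s.
have [d] := ubnP (sumn s); elim: d s => // d IHd s sd.
(* At fixed sum the sum of squares is bounded, so it may be taken downwards. *)
have [q] := ubnP (sumn s * sumn s - sumsq s); elim: q s sd => // q IHq s sd sq ssz.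
have iterE j u t :
    word t *m iter j (mulmx (raise V 2)) u = word (t ++ nseq j 2%N) *m u.
  elim: j t => [|j IH] t /=; first by rewrite cats0.
  by rewrite mulmxA -word_rcons IH cat_rcons.
(* Entries 0 and 1 can be moved to the right, next to v. *)
have [s0|s0] := boolP (0 \in s).
  by case/splitPr: s0 => s1 s2; rewrite word_mid raise0 mulmx0 mul0mx.
have [s1|s1] := boolP (1%N \in s).
  by case/splitPr: s1 => s1 s2; rewrite word_mid -mulmxA v1 mulmx0.
pose b := [seq x <- s | ltn 2 x]; pose c := [seq x <- s | predC (ltn 2) x].
have pbc : perm_eq (b ++ c) s by apply/permPl/perm_filterC.
have [r ec] : exists r, c = nseq r 2%N.
  exists (size c); apply/all_pred1P/allP=> x; rewrite mem_filter /= -leqNgt.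
  case/andP=> x2 xs; case: x x2 xs => [|[|[|x]]] //.
    by rewrite (negPf s0).
  by rewrite (negPf s1).
have b3 : all (leq 3) b by apply: filter_all.
rewrite ec in pbc.
case: b b3 pbc => [|m b] /=.
  by move=> _ pbc; rewrite -(perm_word pbc) -ssz -(perm_size pbc) size_nseq in v2 *.
case/andP=> m2 b3 pbc.
have szE : (size b + r).+1 = l.
  by rewrite -ssz -(perm_size pbc) /= size_cat size_nseq.
have smE : sumn s = (m + sumn b + 2 * r)%N.
  by rewrite -(perm_sumn pbc) /= sumn_cat sumn_nseq addnA.
have sumsq2 j : sumsq (nseq j 2%N) = (4 * j)%N by rewrite /sumsq map_nseq sumn_nseq.
have sqE : sumsq s = (m * m + sumsq b + 4 * r)%N.
  have -> : sumsq s = sumsq (m :: b ++ nseq r 2%N).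
    by apply/esym/perm_sumn; apply: perm_map pbc.
  by rewrite sumsq_cons sumsq_cat sumsq2 addnA.
rewrite -(perm_word pbc).
have := word_twos_transfer b r m2 v1.
have low : word (b ++ nseq r.+1 2%N) *m v = 0.
  by rewrite IHd ?sumn_cat ?sumn_nseq ?size_cat ?size_nseq //; lia.
rewrite -mulmxA tv -scalemxAr low scaler0 word_transfer_eq0 //; last 3 first.
- by elim: (r.+1) => //= j IHj; rewrite mulmxA raiseC -mulmxA IHj mulmx0.
- move=> t tb tsum; rewrite iterE IHd //.
  + by rewrite sumn_cat sumn_nseq; lia.
  + by rewrite size_cat size_nseq; lia.
- move=> t tb tsum tsq; rewrite iterE.
  have tsE : sumn (t ++ nseq r.+1 2%N) = sumn s.
    by rewrite sumn_cat sumn_nseq tsum smE; lia.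
  apply: IHq; rewrite ?tsE // ?sumsq_cat ?sumsq2; last first.
    by rewrite size_cat size_nseq; lia.
  have := sumsq_le (t ++ nseq r.+1 2%N).
  rewrite tsE sumsq_cat sumsq2; lia.
rewrite sub0r => /esym/eqP; rewrite oppr_eq0 scaler_eq0 => /orP[/eqP c0|/eqP //].
(* The subtractions are exact, since size b + k < l and 2 l <= n. *)
have : (\sum_(k < r.+1) (n - 2 * (size b + k)))%:R = 0 :> F.
  rewrite -[RHS]c0 natr_sum; apply: eq_bigr => k _.
  by rewrite emu natrB //; have := ltn_ord k; lia.
move/eqP; rewrite ((pcharf0P F).1 char0) sum_nat_eq0 => /forallP /(_ ord0) /=; lia.
Qed.

End Words.

(** * Words span the dual of the tensor power *)

Inductive raising_span (F : fieldType) (V : yangian_module F)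
    (w0 : 'rV[F]_(ydim V)) : 'rV[F]_(ydim V) -> Prop :=
  | raising_span_base : raising_span w0 w0
  | raising_span_lin c x y : raising_span w0 x -> raising_span w0 y ->
      raising_span w0 (c *: x + y)
  | raising_span_raise k x : raising_span w0 x ->
      raising_span w0 (x *m raise V k).

Section RaisingSpan.
Variables (F : fieldType) (V : yangian_module F) (w0 : 'rV[F]_(ydim V)).

Lemma raising_span0 : raising_span w0 0.
Proof.
rewrite -[0](addNr w0) -scaleN1r.
by apply: raising_span_lin; apply: raising_span_base.
Qed.

Lemma raising_spanZ c x : raising_span w0 x -> raising_span w0 (c *: x).
Proof.
by move=> hx; rewrite -[_ *: _]addr0; apply/raising_span_lin/raising_span0.
Qed.

Lemma raising_spanD x y :
  raising_span w0 x -> raising_span w0 y -> raising_span w0 (x + y).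
Proof. by move=> hx hy; rewrite -[x]scale1r; apply: raising_span_lin. Qed.

Lemma raising_spanB x y :
  raising_span w0 x -> raising_span w0 y -> raising_span w0 (x - y).
Proof. by move=> hx hy; rewrite addrC -scaleN1r; apply: raising_span_lin. Qed.

Lemma raising_span_words_eq0 (v : 'cV[F]_(ydim V)) x :
  (forall s, word w0 s *m v = 0) -> raising_span w0 x -> x *m v = 0.
Proof.
move=> + sx; elim: sx v => [|c y z _ IHy _ IHz|k y _ IH] v v0.
- exact: (v0 [::]).
- by rewrite mulmxDl -scalemxAl IHy // IHz // scaler0 addr0.
- by rewrite -mulmxA IH // => s; rewrite mulmxA -word_rcons.
Qed.

End RaisingSpan.

Lemma tensmxZl (F : fieldType) m n p q c (A : 'M[F]_(m, n)) (B : 'M[F]_(p, q)) :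
  (c *: A) *t B = c *: (A *t B).
Proof. by apply/matrixP=> i j; rewrite !mxE mulrA. Qed.

Lemma tensmxZr (F : fieldType) m n p q c (A : 'M[F]_(m, n)) (B : 'M[F]_(p, q)) :
  A *t (c *: B) = c *: (A *t B).
Proof. by apply/matrixP=> i j; rewrite !mxE mulrCA. Qed.

Section TensorCovector.
Variables (F : fieldType) (V W : yangian_module F).

(** The coproduct in the form used below, with the sum over the intermediate
    index of gl_2 written out. *)
Lemma tens_covectorM (a b : 'I_2) s (x : 'rV[F]_(ydim V)) (y : 'rV[F]_(ydim W)) :
  (x *t y : 'rV_(ydim (ytens V W))) *m yT (ytens V W) a b s =
  \sum_(i < s.+1) ((x *m yT V i1 b i) *t (y *m yT W a i1 (s - i)%N)
                  + (x *m yT V i2 b i) *t (y *m yT W a i2 (s - i)%N)).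
Proof.
rewrite /= /tens_T big_ord_recl big_ord1 mulmxDr.
rewrite (_ : lift ord0 ord0 = i2); last exact: val_inj.
rewrite !mulmx_sumr -big_split; apply: eq_bigr => i _ /=.
by congr (_ + _); rewrite -tensmx_mul.
Qed.

Lemma highest_covector_tens (x : 'rV[F]_(ydim V)) (y : 'rV[F]_(ydim W)) mu nu :
  highest_covector x mu -> highest_covector y nu ->
  highest_covector (x *t y : 'rV_(ydim (ytens V W))) (mu + nu).
Proof.
move=> [x12 x22 x11 xmu] [y12 y22 y11 ynu]; split=> [s|s|s|].
- rewrite tens_covectorM big1 // => i _.
  by rewrite x12 y12 tens0mx tensmx0 addr0.
- rewrite tens_covectorM.
  rewrite big_ord_recl x12 tens0mx add0r x22 y22 subn0 eqxx scale1r tensmxZr.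
  by rewrite big1 ?addr0 // => i _; rewrite x12 x22 scale0r !tens0mx addr0.
- rewrite tens_covectorM.
  apply: (big_ind (fun z => exists c,
      z = c *: (x *t y : 'rV_(ydim (ytens V W))))) => [|_ _ [c ->] [d ->]|i _].
  + by exists 0; rewrite scale0r.
  + by exists (c + d); rewrite scalerDl.
  + rewrite y12 tensmx0 addr0.
    have [c ->] := x11 i; have [d ->] := y11 (s - i)%N; exists (c * d).
    by rewrite tensmxZl tensmxZr scalerA.
- rewrite tens_covectorM big_ord_recl big_ord1 /= subnn !yT_unit.
  rewrite !y12 !tensmx0 !addr0.
  rewrite !mul_mx_scalar !scale1r xmu ynu tensmxZl tensmxZr.
  by rewrite [i1 == i2](_ : _ = false) // scale0r tensmx0 addr0 -scalerDl addrC.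
Qed.

End TensorCovector.

Definition up (F : fieldType) : 'rV[F]_(ydim (yvect F)) := delta_mx 0 i1.
Definition down (F : fieldType) : 'rV[F]_(ydim (yvect F)) := delta_mx 0 i2.

Lemma highest_covector_up (F : fieldType) : highest_covector (up F) 1.
Proof.
rewrite /up; split=> [[|[|s]]|[|[|s]]|[|[|s]]|] /=.
- by rewrite raddf0 mulmx0.
- by rewrite mul_delta_mx_0.
- by rewrite mulmx0.
- by rewrite mulmx1 scale1r.
- by rewrite mul_delta_mx_0 // scale0r.
- by rewrite mulmx0 scale0r.
- by exists 1; rewrite mulmx1 scale1r.
- by exists 1; rewrite mul_delta_mx scale1r.
- by exists 0; rewrite mulmx0 scale0r.
- by rewrite mul_delta_mx scale1r.
Qed.

Lemma raising_span_up (F : fieldType) x : raising_span (up F) x.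
Proof.
have -> : x = x 0 i1 *: up F + x 0 i2 *: (up F *m raise (yvect F) 1).
  rewrite /up /raise /= mul_delta_mx.
  apply/rowP=> j; rewrite !mxE /=.
  by case: (unliftP i1 j) => [k ->|->];
    rewrite ?(ord1 k) /= ?mulr1 ?mulr0 ?addr0 ?add0r //;
    congr (x _ _); apply: val_inj.
apply: raising_span_lin; first exact: raising_span_base.
exact/raising_spanZ/raising_span_raise/raising_span_base.
Qed.

Section AddSite.
Variables (F : fieldType) (W : yangian_module F).
Local Notation VW := (ytens (yvect F) W).
Local Notation "x ** y" := (x *t y : 'rV_(ydim VW)) (at level 40).
Implicit Types (y : 'rV[F]_(ydim W)).

Lemma down_raise y k : (down F ** y) *m raise VW k = down F ** (y *m raise W k).
Proof.
rewrite tens_covectorM big_ord_recl big1 => [|[[|i] ?] _] /=.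
- by rewrite mulmx1 raddf0 mulmx0 tens0mx !addr0 subn0.
- by rewrite /down !mul_delta_mx_0 // !tens0mx addr0.
- by rewrite !mulmx0 !tens0mx addr0.
Qed.

(** On [up] the first factor acts by T_11(u) = 1 + u^-1 and turns [up] into
    [down] through T_21(u), which accounts for the shifted index. *)
Lemma up_raise y k :
  (up F ** y) *m raise VW k.+1 =
  up F ** (y *m raise W k.+1 + y *m raise W k) + down F ** (y *m yT W i2 i2 k).
Proof.
rewrite tens_covectorM 2!big_ord_recl big1 => [|[i ?] _] /=.
  rewrite mulmx1 raddf0 mulmx0 tens0mx !addr0 subn0 /up !mul_delta_mx.
  by rewrite /bump /= subSS subn0 tensmxDr addrA.
by rewrite !mulmx0 !tens0mx addr0.
Qed.

(** At u = -1 the operator T_11(u) annihilates [up], so T_21(-1) sends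
    up ** y0 to a multiple of down ** y0.  From there T_21(u) acts on the second
    factor only, which gives all down ** y; modulo these, it acts on up ** y
    through (1 + u^-1) T_21(u), and all up ** y follow. *)
Lemma raising_span_add_site (y0 : 'rV[F]_(ydim W)) nu N :
  highest_covector y0 nu -> (forall k, (N < k)%N -> raise W k = 0) ->
  (forall y, raising_span y0 y) ->
  forall x, raising_span (up F ** y0) x.
Proof.
move=> [_ y22 _ _] bound IH x.
(* Alternating sums of the coefficients: up to sign, T_21(-1) for large k. *)
have step k : raising_span (up F ** y0)
    (up F ** (y0 *m raise W k.+1) + (-1) ^+ k *: (down F ** y0)).
  elim: k => [|k IHk].
    have := raising_span_raise 1 (raising_span_base (up F ** y0)).
    by rewrite up_raise raise0 mulmx0 addr0 y22 scale1r expr0 scale1r.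
  have := raising_span_raise k.+2 (raising_span_base (up F ** y0)).
  move/raising_spanB/(_ IHk); rewrite up_raise y22 scale0r tensmx0 addr0.
  by rewrite tensmxDr opprD addrA addrK exprS -scalerA scaleN1r.
have down0 : raising_span (up F ** y0) (down F ** y0).
  have := step N; rewrite bound // mulmx0 tensmx0 add0r => h.
  have := raising_spanZ ((-1) ^+ N) h.
  by rewrite scalerA -exprMn mulrNN mulr1 expr1n scale1r.
have downy y : raising_span (up F ** y0) (down F ** y).
  elim: (IH y) => [|c y1 y2 _ h1 _ h2|k y1 _ h1] //.
  - by rewrite tensmxDr tensmxZr; apply: raising_span_lin.
  - by rewrite -down_raise; apply: raising_span_raise.
have upy y : raising_span (up F ** y0) (up F ** y).
  elim: (IH y) => [|c y1 y2 _ h1 _ h2|k y1 _ h1].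
  - exact: raising_span_base.
  - by rewrite tensmxDr tensmxZr; apply: raising_span_lin.
  - elim: k => [|k IHk].
      by rewrite raise0 mulmx0 tensmx0; apply: raising_span0.
    have := raising_span_raise k.+1 h1.
    move/raising_spanB/(_ (downy (y1 *m yT W i2 i2 k)))/raising_spanB/(_ IHk).
    by rewrite up_raise addrK tensmxDr addrK.
have -> : x = up F ** (\row_j x 0 (mxtens_index (i1, j)))
            + down F ** (\row_j x 0 (mxtens_index (i2, j))).
  apply/rowP=> k; case: (mxtens_indexP k) => i j.
  rewrite !mxE !mxtens_indexK (ord1 (@mxtens_unindex 1 1 0).1) eqxx /=.
  by case: (unliftP i1 i) => [k' ->|->];
    rewrite ?(ord1 k') /= ?mul1r ?mul0r ?addr0 ?add0r //;
    congr (x _ (mxtens_index (_, _))); apply: val_inj.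
exact: raising_spanD.
Qed.

End AddSite.

Lemma tens_bound (F : fieldType) (V W : yangian_module F) M N :
  (forall a b k, (M < k)%N -> yT V a b k = 0) ->
  (forall a b k, (N < k)%N -> yT W a b k = 0) ->
  forall a b k, (M + N < k)%N -> yT (ytens V W) a b k = 0.
Proof.
move=> VM WN a b k k_lt; rewrite /= /tens_T big1 // => c _; rewrite big1 // => i _.
have [iM|iM] := ltnP M i; first by rewrite VM // tens0mx.
by rewrite WN ?tensmx0 //; lia.
Qed.

(** The induction also carries a bound on the degree of T(u) in u^-1, without
    which T_21(u) could not be evaluated at u = -1 when a site is added. *)
Lemma L_one_generated (F : fieldType) n : (0 < n)%N ->
  exists2 w : 'rV[F]_(ydim (L_one F n)),
    highest_covector w n%:R & forall x, raising_span w x.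
Proof.
case: n => // n _; rewrite /L_one /=.
have vect_bound a b k : (1 < k)%N -> yT (yvect F) a b k = 0 by case: k => [|[]].
suff [w hw [sw _]] : exists2 w : 'rV[F]_(ydim (iter n (ytens (yvect F)) (yvect F))),
    highest_covector w n.+1%:R & (forall x, raising_span w x) /\
    (forall a b k, (n.+1 < k)%N ->
       yT (iter n (ytens (yvect F)) (yvect F)) a b k = 0).
  by exists w.
elim: n => [|n [w hw [sw bw]]] /=.
  exists (up F); first exact: highest_covector_up.
  by split=> //; apply: raising_span_up.
exists (up F *t w).
  rewrite -[n.+2%:R]natr1 addrC.
  exact: highest_covector_tens (highest_covector_up F) hw.
split; first exact: raising_span_add_site hw (bw _ _) sw.
exact: tens_bound vect_bound bw.
Qed.

(** * Simplicity of the spectrum *)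

Lemma natr_pchar0_inj (F : fieldType) :
  [pchar F] =i pred0 -> injective (fun k => k%:R : F).
Proof.
move=> /(pcharf0P F).1 char0 j k jk.
wlog le_jk : j k jk / (j <= k)%N.
  by move=> h; case: (leqP j k) => [|/ltnW] le; [exact: h | apply/esym/h].
apply/eqP; rewrite eqn_leq le_jk /= -subn_eq0 -char0 natrB //.
by rewrite -jk subrr.
Qed.

(** The form [phi] vanishes on no nonzero joint eigenvector, because the words
    span the dual space and those of length other than l vanish on vectors of
    weight (n-l, l).  Hence a joint eigenvector u equals
    (phi u / phi v) v, the difference being an eigenvector killed by [phi]. *)
Lemma bethe_simple_spectrum (F : fieldType) (n l : nat) :
  [pchar F] =i pred0 -> (0 < n)%N -> (2 * l <= n)%N ->
  simple_spectrum (bethe_algebra (L_one F n) l).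
Proof.
move=> char0 n_gt0 le_ln; have [w hw sw] := L_one_generated F n_gt0.
move: (L_one F n) w hw sw => V w hw sw chi [v v0 Ev].
pose tau m := chi (transfer_on V l m).
pose phi (u : subvs_of (sing V l)) := (word w (nseq l 2%N) *m vsval u) 0 0.
have eigen u : joint_eigenspace (bethe_algebra V l) chi u -> phi u = 0 -> u = 0.
  move=> Eu phi0; have /singP[u1 u2] := subvsP u.
  have tu m : transfer V m *m vsval u = tau m *: vsval u.
    by rewrite -transfer_onE Eu //; apply: subalgebra_gen_in; exists m.
  apply/val_inj; rewrite /= -[vsval u]mul1mx; apply/row_matrixP => i.
  rewrite row_mul row0; apply: (raising_span_words_eq0 _ (sw _)) => s.
  have [sl|sl] := eqVneq (size s) l.
    apply: (word_eigen_eq0 hw char0 erefl le_ln u1 tu _ sl).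
    by apply/rowP=> j; rewrite [j]ord1 [RHS]mxE.
  have /eqP := congr1 (mulmx (word w s)) u2.
  rewrite mulmxA (word_e22 hw) // -scalemxAl -scalemxAr -subr_eq0 -scalerBl.
  by rewrite scaler_eq0 subr_eq0 (inj_eq (natr_pchar0_inj char0)) (negPf sl) => /eqP.
have phi_lin c x y : phi (c *: x + y) = c * phi x + phi y.
  by rewrite /phi (linearP vsval) mulmxDr -scalemxAr !mxE.
have phiv : phi v != 0 by apply: contra_neq v0; apply: eigen.
exists <[v]>%VS; first by rewrite dim_vline v0.
move=> u; split=> [Eu|/vlineP[c ->] f Af]; last first.
  by rewrite linearZ /= Ev // !scalerA mulrC.
apply/vlineP; exists (phi u / phi v).
apply/eqP; rewrite -subr_eq0; apply/eqP/eigen.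
  move=> f Af; rewrite linearB linearZ /= Eu // Ev // scalerBr !scalerA.
  by rewrite [chi f * _]mulrC.
by rewrite -scaleNr addrC phi_lin mulNr divfK // addNr.
Qed.

Theorem theorem12p1p1 (R : realType) (n l : nat)
    (hn : (1 <= n)%N) (hl : (2 * l <= n)%N) :
  simple_spectrum (bethe_algebra (L_one R[i]%C n) l).
Proof. exact: bethe_simple_spectrum (@Num.Theory.pchar_num _) hn hl. Qed.
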